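(* Let $K$ be a field of characteristic zero and let $R=K[u,v,W]$ be graded by $\operatorname{wt}(u)=\operatorname{wt}(v)=1$, $\operatorname{wt}(W)=3$. Let $0\neq S_3\in K[u,v]$ and $R_3\in K[u,v]$ be homogeneous cubic forms ($R_3$ possibly zero), and let $T\in\mathfrak{sl}_2(K)$ with $\det T\neq0$. Consider the two weight-zero derivations of $R$ $$\delta_{\rm acc}=S_3(u,v)\,\partial_W,\qquad \delta_{\rm ss}=\mathcal D_T+R_3(u,v)\,\partial_W .$$ Then there is no irreducible weighted-homogeneous $P\in R$ of weight $m\geqslant3$ such that the prime ideal $(P)$ is stable under both $\delta_{\rm acc}$ and $\delta_{\rm ss}$.
   Context: For $T\in\mathfrak{sl}_2(K)$ (a traceless $2\times2$ matrix), $\mathcal D_T$ is the induced $K$-linear derivation of $K[u,v,W]$ acting linearly on $(u,v)$ by $T$, i.e. $\mathcal D_T\binom uv=T\binom uv$, and with $\mathcal D_T(W)=0$. An ideal $I$ is stable under a derivation $\delta$ if $\delta(I)\subset I$. *)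

(* Defs.v *)
From HB Require Import structures.
From mathcomp Require Import all_boot all_order all_algebra.
From mathcomp Require Export mpoly.

Set Implicit Arguments.
Unset Strict Implicit.
Unset Printing Implicit Defensive.

Import GRing.Theory.
Local Open Scope ring_scope.

Definition irreducible_elt (R : comUnitRingType) (p : R) : Prop :=
  [/\ p != 0, p \isn't a GRing.unit &
      forall a b : R, p = a * b -> a \is a GRing.unit \/ b \is a GRing.unit].

Definition principal_ideal (R : comNzRingType) (p : R) : R -> Prop :=
  fun q => exists r : R, q = r * p.

Definition stable_under (R : Type) (delta : R -> R) (I : R -> Prop) : Prop :=
  forall q : R, I q -> I (delta q).

Definition is_derivation (K : nzRingType) (A : lalgType K) (delta : A -> A) : Prop :=
  linear delta /\ forall p q : A, delta (p * q) = delta p * q + p * delta q.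

(* K[u,v] is {mpoly K[2]} and K[u,v,W] is {mpoly K[3]}, with u, v, W the
   variables of index 0, 1, 2; mwiden is the inclusion of the former in the
   latter, so its last variable W has index ord_max. *)
Definition inuv (i : 'I_2) : 'I_3 := widen_ord (leqnSn 2) i.
Definition iW : 'I_3 := ord_max.

Definition uvW_weight (m : 'X_{1..3}) : nat :=
  (\sum_(i < 2) m (inuv i) + 3 * m iW)%N.

Lemma uvW_weight0 : uvW_weight 0%MM = 0%N.
Proof. by rewrite /uvW_weight big1 ?mnm0E // => i _; rewrite mnm0E. Qed.

Lemma uvW_weightD : {morph uvW_weight : m1 m2 / (m1 + m2)%MM >-> (m1 + m2)%N}.
Proof.
move=> m1 m2; rewrite /uvW_weight mnmDE mulnDr addnACA -big_split /=.
by congr (_ + _)%N; apply: eq_bigr => i _; rewrite mnmDE.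
Qed.

#[hnf] HB.instance Definition _ :=
  isMeasure.Build 3 uvW_weight uvW_weight0 uvW_weightD.

Lemma uvW_weight_uv (i : 'I_2) : uvW_weight U_(inuv i)%MM = 1%N.
Proof.
by case: i => [[|[|i]]] // lt_i2; rewrite /uvW_weight !big_ord_recl big_ord0 !mnm1E.
Qed.

Lemma uvW_weight_W : uvW_weight U_(iW)%MM = 3%N.
Proof. by rewrite /uvW_weight !big_ord_recl big_ord0 !mnm1E. Qed.

Section Derivations.
Variable K : fieldType.
Implicit Types (p q : {mpoly K[3]}) (S F : {mpoly K[2]}) (T : 'M[K]_2).

Definition delta_W S p : {mpoly K[3]} := mwiden S * p^`M(iW).

(* The derivation with (u, v)^T |-> T (u, v)^T and W |-> 0. *)
Definition delta_lin T p : {mpoly K[3]} :=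
  \sum_(i < 2) (\sum_(j < 2) T i j *: 'X_(inuv j)) * p^`M(inuv i).

Definition delta_acc S p : {mpoly K[3]} := delta_W S p.

Definition delta_ss T F p : {mpoly K[3]} := delta_lin T p + delta_W F p.

Lemma delta_W_derivation S : is_derivation (delta_W S).
Proof.
split=> [c p q|p q]; rewrite /delta_W.
  by rewrite mderivD mderivZ mulrDr scalerAr.
by rewrite mderivM mulrDr [X in X + _]mulrA [X in _ + X]mulrCA.
Qed.

Lemma delta_lin_derivation T : is_derivation (delta_lin T).
Proof.
split=> [c p q|p q]; rewrite /delta_lin.
  rewrite scaler_sumr -big_split; apply: eq_bigr => i _ /=.
  by rewrite mderivD mderivZ mulrDr scalerAr.
rewrite mulr_suml mulr_sumr -big_split; apply: eq_bigr => i _ /=.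
by rewrite mderivM mulrDr [X in X + _]mulrA [X in _ + X]mulrCA.
Qed.

Lemma delta_ss_derivation T F : is_derivation (delta_ss T F).
Proof.
have [linT mulT] := delta_lin_derivation T.
have [linW mulW] := delta_W_derivation F.
split=> [c p q|p q]; rewrite /delta_ss.
  by rewrite linT linW scalerDr addrACA.
by rewrite mulT mulW mulrDl mulrDr addrACA.
Qed.

Lemma mderiv_var (i j : 'I_3) : ('X_i : {mpoly K[3]})^`M(j) = (i == j)%:R.
Proof.
rewrite mderivX mnm1E; case: eqP => [->|_]; last by rewrite scale0r.
rewrite scale1r; have -> : (U_(j) - U_(j) = 0 :> 'X_{1..3})%MM.
  by apply/mnmP => k; rewrite mnmBE mnm0E subnn.
by rewrite mpolyX0.
Qed.

Lemma delta_lin_uv T (i : 'I_2) :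
  delta_lin T 'X_(inuv i) = \sum_(j < 2) T i j *: 'X_(inuv j).
Proof.
rewrite /delta_lin (bigD1 i) //= mderiv_var eqxx mulr1 [X in _ + X]big1 ?addr0 // => k ki.
rewrite mderiv_var; case: eqP => [/(congr1 val)/= /val_inj ik|]; last by rewrite mulr0.
by rewrite ik eqxx in ki.
Qed.

Lemma delta_lin_W T : delta_lin T 'X_iW = 0.
Proof.
rewrite /delta_lin big1 // => i _; rewrite mderiv_var.
by case: eqP => [/(congr1 val)/= eqi|]; [case: i eqi => i /= + eqi; rewrite -eqi | rewrite mulr0].
Qed.

Lemma delta_W_uv S (i : 'I_2) : delta_W S 'X_(inuv i) = 0.
Proof.
rewrite /delta_W mderiv_var; case: eqP => [/(congr1 val)/= eqi|]; last by rewrite mulr0.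
by case: i eqi => i /= + eqi; rewrite eqi.
Qed.

Lemma delta_W_W S : delta_W S 'X_iW = mwiden S.
Proof. by rewrite /delta_W mderiv_var eqxx mulr1. Qed.

End Derivations.

(* Main.v *)
From HB Require Import structures.
Require Import Defs.
From mathcomp Require Import all_boot all_order all_algebra ring.

Import GRing.Theory.
Local Open Scope ring_scope.

(** Comparing degrees in [W], [P | S_3 * P_W] forces [P_W = 0], so [P] is a
    binary form of degree [m] in [u, v].  Euler's identity
    [u * P_u + v * P_v = m * P] eliminates [P_v] from [P | D_T P] and leaves
    [P | q * P_u], where [q] is the nonzero [T]-invariant quadratic form.
    On setting [v = 1], the polynomial [p = P(X, 1)] is irreducible of degree
    [m], hence coprime to its derivative, and it divides [q(X, 1)], of degree at
    most 2.  This contradicts [m >= 3]. *)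

(** * Partial derivatives: chain rule and Euler's identity *)

Lemma pchar0_mulrn_eq0 (V : idomainType) (charV0 : [pchar V] =i pred0)
  (x : V) (n : nat) : (x *+ n == 0) = (n == 0)%N || (x == 0).
Proof. by rewrite -mulr_natr mulf_eq0 orbC ((pcharf0P _).1 charV0). Qed.

Lemma mderivXU (R : comNzRingType) (n : nat) (i j : 'I_n) :
  ('X_i : {mpoly R[n]})^`M(j) = (i == j)%:R.
Proof.
rewrite mderivX mnm1E; case: eqP => [->|_]; last by rewrite scale0r.
rewrite scale1r; have -> : (U_(j) - U_(j) = 0 :> 'X_{1..n})%MM.
  by apply/mnmP => k; rewrite mnmBE mnm0E subnn.
by rewrite mpolyX0.
Qed.

(** Both sides are additive in [p] and obey the same Leibniz rule, so this chain rule need only be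
    checked on constants, which stay constant, and on variables. *)
Lemma deriv_mmap (R B : comNzRingType) (n : nat) (g : {rmorphism R -> B})
    (h : 'I_n -> {poly B}) (p : {mpoly R[n]}) :
  (mmap (polyC \o g) h p)^`() =
    \sum_(i < n) mmap (polyC \o g) h p^`M(i) * (h i)^`().
Proof.
pose Q q := (mmap (polyC \o g) h q)^`() =
  \sum_(i < n) mmap (polyC \o g) h q^`M(i) * (h i)^`().
have QD q r : Q q -> Q r -> Q (q + r).
  rewrite /Q => Qq Qr; rewrite raddfD derivD Qq Qr -big_split.
  by apply: eq_bigr => i _ /=; rewrite mderivD raddfD mulrDl.
have QM q r : Q q -> Q r -> Q (q * r).
  rewrite /Q => Qq Qr; rewrite rmorphM derivM Qq Qr mulr_suml mulr_sumr -big_split.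
  apply: eq_bigr => i _ /=.
  by rewrite mderivM rmorphD !rmorphM /= mulrDl mulrA [X in X + _]mulrAC.
have QC c : Q c%:MP.
  rewrite /Q mmapC /= derivC big1 // => i _.
  by rewrite mderivC raddf0 mul0r.
have QX i : Q 'X_i.
  rewrite /Q mmapX mmap1U (bigD1 i) //= mderivXU eqxx rmorph1 mul1r.
  rewrite big1 ?addr0 // => j ji.
  by rewrite mderivXU eq_sym (negbTE ji) raddf0 mul0r.
rewrite -/(Q p) (mpolyE p).
apply: (big_ind Q) => [|//|m _]; first by rewrite -mpolyC0.
rewrite -mul_mpolyC mpolyXE_id; apply: (QM) => //.
apply: (big_ind Q) => [|//|i _]; first by rewrite -mpolyC1.
by elim: (m i) => [|k IH]; [rewrite expr0 -mpolyC1 | rewrite exprS; apply: (QM)].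
Qed.

(** A monomial is an eigenvector of ['X_i] times the [i]-th derivative, with its exponent as
    eigenvalue; the weighted exponents add up to [d]. *)
Lemma mpoly_euler (R : comNzRingType) (n d : nat) (mf : measure n)
    (p : {mpoly R[n]}) :
  p \is d.-homog for mf ->
  \sum_(i < n) 'X_i * p^`M(i) *+ mf U_(i)%MM = p *+ d.
Proof.
move/dhomogP => hp; rewrite [in RHS](mpolyE p) [in LHS](mpolyE p) -sumrMnl.
transitivity (\sum_(m <- msupp p) \sum_(i < n)
    (p@_m *: 'X_[m]) *+ (m i * mf U_(i)%MM)).
  rewrite exchange_big; apply: eq_bigr => i _ /=.
  rewrite raddf_sum mulr_sumr -sumrMnl; apply: eq_bigr => m _ /=.
  rewrite mulrnA mderivZ mderivX -!scalerAr scaler_nat.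
  congr (_ *+ _); rewrite scalerMnr; congr (_ *: _).
  (* Subtraction of monomials is truncated: if [m i = 0] the multiplicity kills the term, otherwise
     ['X_i] does divide the monomial. *)
  case: (posnP (m i)) => [->|mi]; first by rewrite !mulr0n.
  rewrite -mpolyXD addmC submK //.
  by apply/mnm_lepP => j; rewrite mnm1E; case: eqP => // <-.
rewrite [LHS]big_seq [RHS]big_seq; apply: eq_bigr => m /hp <-.
by rewrite sumrMnr -mfE.
Qed.

(** * Degree comparison in one variable *)

Lemma deriv_dvd_eq0 (R : idomainType) (f s r : {poly R}) :
  s != 0 -> (size s <= 1)%N -> s * f^`() = r * f -> f^`() = 0.
Proof.
move=> s0 /size1_polyC s_c; rewrite {}s_c in s0 *; move: s`_0 s0 => c.
rewrite polyC_eq0 mul_polyC => c0 eq; apply/eqP/negPn/negP => df0.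
have f0 : f != 0 by apply: contraNneq df0 => ->; rewrite derivC.
(* A nonzero derivative would be a multiple of [f], up to the constant [c], yet of smaller size. *)
have : (size f <= size (c *: f^`()))%N.
  rewrite eq mulrC; apply: dvdp_leq.
    by rewrite mulrC -eq -mul_polyC mulf_neq0 ?polyC_eq0.
  exact: dvdp_mulr.
by rewrite size_scale // leqNgt lt_size_deriv.
Qed.

Section UnivariateView.
Variables (R : idomainType) (n : nat) (i : 'I_n).
Implicit Types p s : {mpoly R[n]}.

(* The coefficients stay in [R[X_1..X_n]] instead of losing the variable [i], so
   that evaluation at ['X_i] is a left inverse. *)
Definition muni_at p : {poly {mpoly R[n]}} :=
  mmap (polyC \o @mpolyC n R) (fun j => if j == i then 'X else ('X_j)%:P) p.

Lemma muni_atM : {morph muni_at : p s / p * s}.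
Proof. exact: rmorphM. Qed.

Lemma muni_atK p : (muni_at p).['X_i] = p.
Proof.
rewrite /muni_at /mmap horner_sum [RHS](mpolyE p); apply: eq_bigr => m _.
rewrite hornerM hornerC /mmap1 horner_prod mul_mpolyC; congr (_ *: _).
rewrite [RHS]mpolyXE_id; apply: eq_bigr => j _; rewrite horner_exp.
by case: eqP => [->|_]; rewrite ?hornerX ?hornerC.
Qed.

Lemma deriv_muni_at p : (muni_at p)^`() = muni_at p^`M(i).
Proof.
rewrite [LHS](@deriv_mmap R _ n (@mpolyC n R)).
rewrite (bigD1 i) //= (eqxx i) derivX.
rewrite big1 => [|j ji].
  rewrite addr0. exact: mulr1.
by rewrite (negbTE ji) derivC mulr0.
Qed.

(** The size bound says that [s] does not involve ['X_i]. The relation is read as one between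
    univariate polynomials, and evaluation at ['X_i] brings the conclusion back. *)
Lemma mderiv_dvd_eq0 p s r : s != 0 -> (size (muni_at s) <= 1)%N ->
  s * p^`M(i) = r * p -> p^`M(i) = 0.
Proof.
move=> s0 sz eq; rewrite -(muni_atK p^`M(i)) -deriv_muni_at.
rewrite (@deriv_dvd_eq0 _ (muni_at p) (muni_at s) (muni_at r)) ?horner0 //.
  by apply: contraNneq s0 => s0; rewrite -(muni_atK s) s0 horner0.
rewrite deriv_muni_at.
rewrite -[LHS](muni_atM s).
rewrite eq.
exact: muni_atM.
Qed.

End UnivariateView.
Arguments muni_at {R n} i p.

Lemma size_muni_at_mwiden (R : idomainType) (n : nat) (s : {mpoly R[n]}) :
  (size (muni_at ord_max (mwiden s)) <= 1)%N.
Proof.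
suff -> : muni_at ord_max (mwiden s) = (mwiden s)%:P by exact: size_polyC_leq1.
rewrite /mwiden /mmap /muni_at !rmorph_sum; apply: eq_bigr => m _ /=.
rewrite !rmorphM /= mmapC; congr (_ * _); rewrite /mmap1 !rmorph_prod.
apply: eq_bigr => j _; rewrite !rmorphXn /= mmapX mmap1U.
by case: eqP => // /(congr1 val)/= E; have := ltn_ord j; rewrite E ltnn.
Qed.

(** * Homogenization of univariate polynomials *)

Section Homogenization.
Variables (R : comNzRingType) (A : comAlgType R) (x y : A).
Implicit Types f g : {poly R}.

(* Only meaningful for [size f <= n.+1]: higher coefficients are dropped. *)
Definition homogenize n f : A := \sum_(i < n.+1) f`_i *: (x ^+ i * y ^+ (n - i)).

Lemma homogenize_is_linear n : linear (homogenize n).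
Proof.
move=> c f g; rewrite /homogenize scaler_sumr -big_split; apply: eq_bigr => i _ /=.
by rewrite coefD coefZ scalerDl scalerA.
Qed.

HB.instance Definition _ n :=
  GRing.isLinear.Build R {poly R} A _ (homogenize n) (homogenize_is_linear n).

Lemma homogenizeXn n i : (i <= n)%N -> homogenize n 'X^i = x ^+ i * y ^+ (n - i).
Proof.
move=> le_in; rewrite /homogenize (bigD1 (Ordinal (le_in : (i < n.+1)%N))) //=.
rewrite coefXn eqxx scale1r big1 ?addr0 // => j; rewrite -val_eqE /= => ji.
by rewrite coefXn (negbTE ji) scale0r.
Qed.

Lemma poly_sum_le n f : (size f <= n)%N -> f = \sum_(i < n) f`_i *: 'X^i.
Proof.
move=> sf; rewrite -poly_def; apply/polyP => i; rewrite coef_poly.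
by case: ltnP => // /(leq_trans sf)/(nth_default 0) ->.
Qed.

(** Bilinearity reduces this to monomials; the size bounds keep every coefficient and make the
    truncated exponents of [y] exact. *)
Lemma homogenizeM n k f g : (size f <= n.+1)%N -> (size g <= k.+1)%N ->
  homogenize (n + k) (f * g) = homogenize n f * homogenize k g.
Proof.
move=> /poly_sum_le -> /poly_sum_le ->; rewrite mulr_suml !linear_sum /= mulr_suml.
apply: eq_bigr => i _; rewrite mulr_sumr !linear_sum mulr_sumr.
apply: eq_bigr => j _; rewrite -scalerAl -scalerAr !linearZ /=.
have lin : (i <= n)%N by rewrite -ltnS.
have ljk : (j <= k)%N by rewrite -ltnS.
rewrite -scalerAl -scalerAr -exprD (homogenizeXn _ _ (leq_add lin ljk)).
rewrite (homogenizeXn _ _ lin) (homogenizeXn _ _ ljk) mulrACA -!exprD.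
by rewrite subnDA -addnBAC // addnBA.
Qed.

End Homogenization.
Arguments homogenize {R A} x y n f.

(** * Coordinates [u], [v], [W] and restriction to [v = 1] *)

Lemma sum_ord2 (V : nmodType) (F : 'I_2 -> V) : \sum_(i < 2) F i = F 0 + F 1.
Proof.
by rewrite big_ord_recl big_ord1; congr (_ + F _); apply/val_inj.
Qed.

Local Notation iu := (inuv 0%R).
Local Notation iv := (inuv 1%R).

Lemma sum_uvW (V : nmodType) (F : 'I_3 -> V) :
  \sum_(i < 3) F i = F iu + F iv + F iW.
Proof. by rewrite big_ord_recr -(sum_ord2 _ (fun i => F (inuv i))). Qed.

Lemma det_mx2 (R : comNzRingType) (A : 'M[R]_2) :
  \det A = A 0 0 * A 1 1 - A 0 1 * A 1 0.
Proof.
rewrite (expand_det_row _ 0) sum_ord2 /cofactor !det_mx11 !mxE /= expr0 expr1.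
rewrite mul1r mulN1r mulrN; congr (_ * A _ _ - _ * A _ _); exact/val_inj.
Qed.

Section Dehomogenization.
Variable K : fieldType.
Hypothesis charK0 : [pchar K] =i pred0.
Implicit Type P : {mpoly K[3]}.

(** The [idfun] gives the coefficient map the shape that [deriv_mmap] expects. *)
Definition dehomogenize P : {poly K} :=
  mmap (polyC \o idfun) (fun i : 'I_3 => [:: 'X; 1; 0]`_i) P.

Lemma dehomogenizeM : {morph dehomogenize : P Q / P * Q}.
Proof. exact: rmorphM. Qed.

Lemma dehomogenizeD : {morph dehomogenize : P Q / P + Q}.
Proof. exact: rmorphD. Qed.

Lemma dehomogenizeZ c P : dehomogenize (c *: P) = c%:P * dehomogenize P.
Proof. exact: mmapZ. Qed.

Lemma dehomogenizeX i : dehomogenize 'X_i = [:: 'X; 1; 0]`_i.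
Proof. by rewrite /dehomogenize mmapX mmap1U. Qed.

Lemma deriv_dehomogenize P : (dehomogenize P)^`() = dehomogenize P^`M(iu).
Proof.
rewrite [LHS](@deriv_mmap K _ 3 (@idfun K)) sum_uvW /=.
by rewrite derivX derivC deriv0 !mulr0 !addr0 mulr1.
Qed.

Section Homogeneous.
Variables (m : nat) (P : {mpoly K[3]}).
Hypotheses (P_homog : P \is m.-homog for uvW_weight) (P_W0 : P^`M(iW) = 0).

Lemma msupp_uv mu : mu \in msupp P ->
  mu iW = 0%N /\ (mu iu + mu iv = m)%N.
Proof.
move=> mu_P.
have muW : mu iW = 0%N.
  apply/eqP; rewrite -leqn0 leqNgt; apply/negP => mu_gt0.
  (* This coefficient of the [W]-derivative is a positive multiple of [P@_mu], hence nonzero in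
     characteristic zero. *)
  have := congr1 (mcoeff (mu - U_(iW))%MM) P_W0.
  rewrite mcoeff_deriv mcoeff0 submK; last first.
    by apply/mnm_lepP => j; rewrite mnm1E; case: eqP => // <-.
  move/eqP; rewrite (pchar0_mulrn_eq0 _ charK0) /= => /negPn.
  by rewrite -mcoeff_msupp mu_P.
split=> //; rewrite -[m](dhomogP _ _ _ P_homog mu mu_P) /= /uvW_weight muW.
by rewrite big_ord_recl big_ord1 addn0; congr (_ + mu _)%N; apply/val_inj.
Qed.

Lemma dehomogenizeE :
  dehomogenize P = \sum_(mu <- msupp P) P@_mu *: 'X^(mu iu).
Proof.
rewrite /dehomogenize /mmap big_seq [RHS]big_seq; apply: eq_bigr => mu /msupp_uv[muW _].
rewrite -mul_polyC; congr (_ * _).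
rewrite /mmap1 2!big_ord_recr big_ord1 /= (muW : mu ord_max = _) expr1n !mulr1.
by congr ('X^(mu _)); apply/val_inj.
Qed.

Lemma size_dehomogenize : (size (dehomogenize P) <= m.+1)%N.
Proof.
rewrite dehomogenizeE big_seq; apply: (leq_trans (size_sum _ _ _)).
apply/bigmax_leqP_seq => mu mu_P _; have [_ <-] := msupp_uv _ mu_P.
by rewrite (leq_trans (size_scale_leq _ _)) // size_polyXn ltnS leq_addr.
Qed.

(** The exponent of [v] lost at [v = 1] is recovered as [m] minus that of [u]. *)
Lemma homogenizeK :
  homogenize ('X_iu) ('X_iv) m (dehomogenize P) = P.
Proof.
rewrite dehomogenizeE linear_sum /= [RHS]mpolyE big_seq [RHS]big_seq.
apply: eq_bigr => mu /msupp_uv[muW <-]; rewrite linearZ /= homogenizeXn ?leq_addr //.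
rewrite addKn [in RHS]mpolyXE_id big_ord_recr /= (muW : mu ord_max = _) mulr1.
by rewrite big_ord_recl big_ord1; congr (_ *: (_ * 'X_ _ ^+ mu _)); apply/val_inj.
Qed.

Lemma dehomogenize_euler :
  'X * dehomogenize P^`M(iu) + dehomogenize P^`M(iv) = dehomogenize P *+ m.
Proof.
rewrite /dehomogenize -raddfMn -(mpoly_euler _ _ _ _ _ P_homog) sum_uvW P_W0.
rewrite mulr0 mul0rn addr0 /= !uvW_weight_uv !mulr1n -!/(dehomogenize _).
by rewrite dehomogenizeD !dehomogenizeM !dehomogenizeX mul1r.
Qed.

(** Euler's identity replaces the [v]-derivative. The quadratic factor is the determinant of the
    columns [T w] and [w], for [w = (u, v)], at [v = 1]; it detects the eigenvectors of [T]. *)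
Lemma dehomogenize_delta_ss (T : 'M[K]_2) (F : {mpoly K[2]}) :
  dehomogenize (delta_ss T F P) =
    ((T 0 1)%:P + (T 0 0 - T 1 1)%:P * 'X - (T 1 0)%:P * 'X ^+ 2) * (dehomogenize P)^`()
    + ((T 1 1)%:P + (T 1 0)%:P * 'X) * (dehomogenize P *+ m).
Proof.
rewrite /delta_ss /delta_W P_W0 mulr0 addr0 /delta_lin sum_ord2 !sum_ord2.
rewrite dehomogenizeD !dehomogenizeM !dehomogenizeD !dehomogenizeZ !dehomogenizeX /=.
rewrite -dehomogenize_euler deriv_dehomogenize polyCB.
ring.
Qed.

(** Homogenizing lifts a factorization at [v = 1] to one of [P], in which a factor that is a unit
    must have degree 0. *)
Lemma dehomogenize_irreducible : (1 < m)%N -> irreducible_elt P ->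
  irreducible_poly (dehomogenize P) /\ size (dehomogenize P) = m.+1.
Proof.
move=> m_gt1 [P0 Pnu Pfact]; set p := dehomogenize P.
have p0 : p != 0 by apply: contraNneq P0 => p0; rewrite -homogenizeK -/p p0 raddf0.
have unit0 n (f : {poly K}) :
    homogenize ('X_iu : {mpoly K[3]}) 'X_iv n f \is a GRing.unit -> n = 0%N.
  (* A unit has a nonzero value at the origin, where a form of positive degree vanishes. *)
  move/(rmorph_unit (meval (fun=> 0 : K))); case: n => // n.
  rewrite raddf_sum big1 ?unitr0 // => i _ /=.
  rewrite mevalZ mevalM !rmorphXn /= !mevalXU -exprD subnKC -1?ltnS //.
  by rewrite exprS mul0r mulr0.
have fact n k (f g : {poly K}) : (n + k = m)%N -> (size f <= n.+1)%N ->
    (size g <= k.+1)%N -> p = f * g -> n = 0%N \/ k = 0%N.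
  move=> nkm sf sg pfg.
  have := Pfact (homogenize 'X_iu 'X_iv n f) (homogenize 'X_iu 'X_iv k g).
  rewrite -homogenizeM // nkm -pfg homogenizeK.
  by case=> // /unit0; [left | right].
have szp : size p = m.+1.
  apply/eqP; rewrite eqn_leq size_dehomogenize ltnNge; apply/negP => szp.
  (* In degree 1 the constant [1] homogenizes to [v]: a drop in degree would make [v] a proper
     factor of [P]. *)
  have := fact 1%N m.-1 1 p; rewrite size_poly1 mul1r add1n prednK ?(ltnW m_gt1) //.
  by case=> // m1; case: (m) m1 m_gt1 => [|[|]].
split=> //; split=> [|q sq /dvdpP[c pE]]; first by rewrite szp ltnS ltnW.
have c0 : c != 0 by apply: contraNneq p0 => c0; rewrite pE c0 mul0r.
have q0 : q != 0 by apply: contraNneq p0 => q0; rewrite pE q0 mulr0.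
rewrite -size_poly_gt0 in c0; rewrite -size_poly_gt0 in q0.
have := fact (size c).-1 (size q).-1 c q; rewrite !prednK //.
case=> //.
- move: szp; rewrite pE size_mul -?size_poly_gt0 //.
  by case: (size c) c0 (size q) q0 => // a _ [] // b _; rewrite addSn addnS /= => -[].
- move=> sc; have /size_poly1P[d d0 cE] : size c == 1%N by rewrite -(prednK c0) sc.
  by rewrite pE cE mul_polyC eqp_sym eqp_scale.
- by move=> sq0; case/eqP: sq; rewrite -(prednK q0) sq0.
Qed.

End Homogeneous.

End Dehomogenization.

(** * Degree contradiction for a common invariant prime *)

Theorem proposition2p4 (K : fieldType) (charK0 : [pchar K] =i pred0)
    (S3 R3 : {mpoly K[2]}) (T : 'M[K]_2)
    (S3_neq0 : S3 != 0) (S3_homog : S3 \is 3.-homog) (R3_homog : R3 \is 3.-homog)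
    (T_sl2 : \tr T = 0) (detT_neq0 : \det T != 0) :
  ~ exists (m : nat) (P : {mpoly K[3]}),
      (3 <= m)%N /\
      irreducible_elt P /\
      P \is m.-homog for uvW_weight /\
      stable_under (delta_acc S3) (principal_ideal P) /\
      stable_under (delta_ss T R3) (principal_ideal P).
Proof.
move=> [m [P [m_ge3 [P_irr [P_homog [stab_acc stab_ss]]]]]].
have P_in : principal_ideal P P by exists 1; rewrite mul1r.
have [r accE] := stab_acc P P_in; have [s ssE] := stab_ss P P_in.
have P_W0 : P^`M(iW) = 0.
  apply: (mderiv_dvd_eq0 _ _ _ _ _ _ _ (size_muni_at_mwiden _ _ S3) accE).
  by rewrite -(mwiden0 2 K) (inj_eq (@inj_mwiden 2 K)).
have [p_irr szp] :=
  dehomogenize_irreducible K charK0 m P P_homog P_W0 (ltnW m_ge3) P_irr.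
have /esym := dehomogenize_delta_ss K m P P_homog P_W0 T R3.
rewrite ssE dehomogenizeM; set p := dehomogenize K P in p_irr szp *.
set q := (X in X * _ + _) => eq_p.
(* The coefficient list serves both to bound the size of [q] and to show [q != 0]. *)
have q_def : q = \poly_(i < 3) [:: T 0 1; T 0 0 - T 1 1; - T 1 0]`_i.
  rewrite poly_def !big_ord_recl big_ord0 /= addr0 -!mul_polyC polyCN /q; ring.
have two_neq0 : (2%:R : K) != 0 by rewrite ((pcharf0P K).1 charK0).
(* If [q = 0], then [T] is scalar; trace zero and [2 != 0] make it zero, against the determinant
   hypothesis. *)
have q0 : q != 0.
  apply: contraNneq detT_neq0 => q0.
  have coefq i : (i < 3)%N -> [:: T 0 1; T 0 0 - T 1 1; - T 1 0]`_i = 0.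
    by move=> i3; rewrite -[RHS](coef0 K i) -q0 q_def coef_poly i3.
  have T01 := coefq 0%N isT; have Td := coefq 1%N isT; have T10 := coefq 2%N isT.
  move: T_sl2; rewrite /mxtrace sum_ord2 det_mx2 => trT.
  have T00 : T 0 0 = 0.
    apply: (mulfI two_neq0).
    rewrite mulr0 -[RHS](addr0 0) -[X in _ = X + _]trT -[X in _ = _ + X]Td /=; ring.
  by rewrite T00 /= in T01 *; rewrite T01 !mul0r subr0.
have szq : (size q <= 3)%N by rewrite q_def size_poly.
(* The coefficient of degree [m.-1] in the derivative is [m] times the leading coefficient of
   [p]. *)
have dp0 : p^`() != 0.
  apply/negP => /eqP/(congr1 (fun f : {poly K} => f`_m.-1))/eqP.
  have m_gt0 : (0 < m)%N by apply: leq_trans m_ge3.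
  rewrite coef_deriv coef0 prednK // (pchar0_mulrn_eq0 _ charK0).
  have -> : p`_m = lead_coef p by rewrite /lead_coef szp.
  by rewrite lead_coef_eq0 (gtn_eqF m_gt0) (negbTE (irredp_neq0 p_irr)).
have p_dvd : p %| q * p^`().
  rewrite -[q * _](addrK (((T 1 1)%:P + (T 1 0)%:P * 'X) * (p *+ m))) eq_p.
  by rewrite mulrnAr -mulrnAl dvdp_sub ?dvdp_mull.
(* Otherwise the gcd is associate to [p], and [p] divides a nonzero polynomial of smaller size. *)
have cop : coprimep p p^`().
  rewrite coprimep_def; apply/negPn/negP => /(p_irr.2 _)/(_ (dvdp_gcdl _ _)) gcd_p.
  have := dvdp_leq dp0 (dvdp_gcdr p p^`()).
  by rewrite (eqp_size gcd_p) leqNgt lt_size_deriv // irredp_neq0.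
(* Now [p] divides [q], so [m + 1 <= 3]. *)
move: p_dvd; rewrite Gauss_dvdpl // => /(dvdp_leq q0).
by rewrite szp => /leq_trans/(_ szq); rewrite ltnS leqNgt m_ge3.
Qed.
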